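(* For every $n\ge 4$, the full transformation semigroup $\mathcal{T}_n$ on an $n$-element set has no involution matching through strong inverses; that is, there is no map $\alpha\mapsto\alpha'$ of $\mathcal{T}_n$ to itself such that $(\alpha')'=\alpha$ and $\alpha'$ is a strong inverse of $\alpha$ for all $\alpha\in\mathcal{T}_n$.
   Context: For an element $a$ of a semigroup $S$, an inverse of $a$ is an element $b\in S$ with $aba=a$ and $bab=b$. An inverse semigroup is a semigroup in which each element has exactly one inverse. An inverse $b$ of $a$ is a strong inverse of $a$ if the subsemigroup $\langle a,b\rangle$ of $S$ generated by $a$ and $b$ is an inverse semigroup. *)

(* Defs.v *)
From HB Require Import structures.
From mathcomp Require Import all_boot.
Set Implicit Arguments.
Unset Strict Implicit.
Unset Printing Implicit Defensive.

Local Open Scope group_scope.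

Definition is_inverse (S : semigroupType) (a b : S) : Prop :=
  a * b * a = a /\ b * a * b = b.

Inductive subsemigroup_gen (S : semigroupType) (A : S -> Prop) : S -> Prop :=
| Gen_in x : A x -> subsemigroup_gen A x
| Gen_mul x y :
    subsemigroup_gen A x -> subsemigroup_gen A y -> subsemigroup_gen A (x * y).

(* The subset P of S, with the multiplication induced from S, is an inverse   *)
(* semigroup; note that inverses are sought inside P only.                    *)
Definition is_inverse_semigroup (S : semigroupType) (P : S -> Prop) : Prop :=
  (forall x y, P x -> P y -> P (x * y)) /\
  (forall x, P x -> exists! y, P y /\ is_inverse x y).

Definition is_strong_inverse (S : semigroupType) (a b : S) : Prop :=
  is_inverse a b /\
  is_inverse_semigroup (subsemigroup_gen (fun x => x = a \/ x = b)).

(* The full transformation semigroup on X. This is a separate type because    *)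
(* {ffun X -> X} carries the pointwise product whenever X has a product.      *)
Definition transformation (X : finType) : Type := {ffun X -> X}.

HB.instance Definition _ (X : finType) := Finite.on (transformation X).

Section TransformationSemigroup.
Variable X : finType.
Implicit Types f g h : transformation X.

(* Transformations act on the right: f * g is f followed by g. *)
Definition transformation_mul f g : transformation X := [ffun x => g (f x)].

Fact transformation_mulA : associative transformation_mul.
Proof. by move=> f g h; apply/ffunP=> x; rewrite !ffunE. Qed.

HB.instance Definition _ :=
  isSemigroup.Build (transformation X) transformation_mulA.

End TransformationSemigroup.

Definition involution_matching_strong (S : semigroupType) (inv : S -> S) : Prop :=
  involutive inv /\ forall a : S, is_strong_inverse a (inv a).

(* Main.v *)
Require Import Defs.
From mathcomp Require Import all_boot perm.

(** If [b] is the inverse of [a] in an inverse subsemigroup, then [b * b] is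
    the inverse of [a * a], and idempotents are their own inverses.  Hence, for
    an idempotent [e], a matching through strong inverses maps the set [N e] of
    the [a <> e] with [a * a = e] and [a * e = e] to itself; it fixes no
    [a] in [N e], for otherwise [a = a * a * a = e].  So an involution matching
    forces [N e] to have even size.  Take four points [p, q, r, s] and let [e]
    collapse [q, r, s] to [p] and fix everything else.  Conjugation by the
    transposition [(q r)] is an involution of [N e] whose only fixed point is
    the map sending [q] and [r] to [s] and [s] to [p]; so [N e] has odd size. *)

Set Implicit Arguments.
Unset Strict Implicit.
Unset Printing Implicit Defensive.

Local Open Scope group_scope.

(** Induction on the cardinality: deleting an orbit [x], [f x] removes exactly two elements and
    leaves a set still stable under [f]. *)
Lemma card_even_fixfree_involution (T : finType) (A : {set T}) (f : T -> T) :
  {in A, forall x, f x \in A} -> {in A, forall x, f x != x} ->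
  {in A, cancel f f} -> ~~ odd #|A|.
Proof.
have [m] := ubnP #|A|; elim: m A => // m IH A /ltnSE-leA fA ff fK.
have [->|[x xA]] := set_0Vmem A; first by rewrite cards0.
have fxA : f x \in A :\ x by rewrite !inE ff ?fA.
have cA : #|A| = #|A :\ x :\ f x|.+2.
  by rewrite (cardsD1 x) xA (cardsD1 (f x) (A :\ x)) fxA.
rewrite cA /= negbK; apply: IH.
- by rewrite cA in leA; apply: ltnW.
- move=> y; rewrite !inE => /and3P[yfx yx yA]; rewrite fA // andbT.
  apply/andP; split; apply: contraNneq yx => fy.
    by rewrite -(fK y) // fy fK.
  by case/eqP: yfx; rewrite -fy fK.
- by move=> y; rewrite !inE => /and3P[_ _]; apply: ff.
- by move=> y; rewrite !inE => /and3P[_ _]; apply: fK.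
Qed.

(** * Idempotents and inverses of products in an inverse subsemigroup *)

Section InverseSemigroup.
Variables (S : semigroupType) (P : S -> Prop).
Hypothesis invP : is_inverse_semigroup P.
Implicit Types x y z e f : S.

Lemma is_inverse_uniq x y z :
  P x -> P y -> P z -> is_inverse x y -> is_inverse x z -> y = z.
Proof.
move=> Px Py Pz xy xz; have [w [_ uw]] := invP.2 x Px.
by rewrite -(uw y) // -(uw z).
Qed.

Lemma idempotent_is_inverse e : e * e = e -> is_inverse e e.
Proof. by move=> ee; split; rewrite !ee. Qed.

Lemma is_inverse_idempotent e y :
  P e -> P y -> e * e = e -> is_inverse e y -> y = e.
Proof.
move=> Pe Py ee ey.
exact: (is_inverse_uniq Pe Py Pe ey (idempotent_is_inverse ee)).
Qed.

(** If [x] is the inverse of [e * f], then so is [f * x * e], hence both agree. This makes [x]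
    idempotent, thus its own inverse and equal to [e * f]. *)
Lemma mul_idempotents e f :
  P e -> P f -> e * e = e -> f * f = f -> e * f * (e * f) = e * f.
Proof.
move=> Pe Pf ee ff; have Pef : P (e * f) by apply: invP.1.
have [x [[Px [xl xr]] _]] := invP.2 _ Pef.
have Pfxe : P (f * x * e) by do !apply: invP.1.
have fxe_inv : is_inverse (e * f) (f * x * e).
  split.
    by rewrite -[RHS]xl !mulgA -(mulgA e f f) ff -(mulgA _ e e) ee.
  rewrite -[in RHS]xr !mulgA -(mulgA _ e e) ee -(mulgA _ f f).
  by rewrite ff.
have xE : f * x * e = x := is_inverse_uniq Pef Pfxe Px fxe_inv (conj xl xr).
have xx : x * x = x.
  have -> : x * x = f * (x * (e * f) * x) * e by rewrite -{1 2}xE !mulgA.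
  by rewrite xr.
suff -> : e * f = x by [].
exact: is_inverse_idempotent Px Pef xx (conj xr xl).
Qed.

(** The idempotents [e * f] and [f * e] are inverse to each other, and an idempotent is its own only
    inverse. *)
Lemma idempotents_commute e f :
  P e -> P f -> e * e = e -> f * f = f -> e * f = f * e.
Proof.
move=> Pe Pf ee ff; have Pef : P (e * f) by apply: invP.1.
have Pfe : P (f * e) by apply: invP.1.
have eef := mul_idempotents Pe Pf ee ff.
have ffe := mul_idempotents Pf Pe ff ee.
apply/esym/is_inverse_idempotent => //; split.
  by rewrite -[RHS]eef !mulgA -(mulgA e f f) ff -(mulgA _ e e) ee.
by rewrite -[RHS]ffe !mulgA -(mulgA f e e) ee -(mulgA _ f f) ff.
Qed.

(** The idempotents [x' * x] and [y * y'] meet in the middle of the products and can be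
    interchanged. *)
Lemma is_inverse_mul x x' y y' :
  P x -> P x' -> P y -> P y' -> is_inverse x x' -> is_inverse y y' ->
  is_inverse (x * y) (y' * x').
Proof.
move=> Px Px' Py Py' [xl xr] [yl yr].
have comm : x' * x * (y * y') = y * y' * (x' * x).
  apply: idempotents_commute; try exact: invP.1.
    by rewrite mulgA xr.
  by rewrite mulgA yl.
split.
  have -> : x * y * (y' * x') * (x * y) = x * (y * y' * (x' * x)) * y.
    by rewrite !mulgA.
  by rewrite -comm -[in RHS]xl -[in RHS]yl !mulgA.
have -> : y' * x' * (x * y) * (y' * x') = y' * (x' * x * (y * y')) * x'.
  by rewrite !mulgA.
by rewrite comm -[in RHS]xr -[in RHS]yr !mulgA.
Qed.

End InverseSemigroup.

(** The set [N e]. Its members also satisfy [e * a = e], both sides being [a * a * a]. *)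
Definition square_roots (S : semigroupType) (e : S) : pred S :=
  fun a => [&& a * a == e, a * e == e & a != e].

(** * Strong inverses of members of [N e] *)

Section StrongInverse.
Variables (S : semigroupType) (e a b : S).
Hypotheses (ee : e * e = e) (a_root : square_roots e a).
Hypothesis ab : is_strong_inverse a b.

Lemma strong_inverse_square_roots : square_roots e b.
Proof.
have /and3P[/eqP aa /eqP ae ane] := a_root; have [iab invP] := ab.
set P := subsemigroup_gen _ in invP.
have Pa : P a by apply: Gen_in; left.
have Pb : P b by apply: Gen_in; right.
have Pe : P e by rewrite -aa; apply: invP.1.
have Pbb : P (b * b) by apply: invP.1.
have bb : b * b = e.
  apply: (is_inverse_idempotent invP) => //.
  by rewrite -aa; apply: (is_inverse_mul invP).
have ea : e * a = e by rewrite -[in RHS]ae -aa mulgA.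
(* As [e] is its own inverse, [b * e] is the inverse of [e * a = e]. *)
have be : b * e = e.
  apply: (is_inverse_idempotent invP) => //; first exact: invP.1.
  rewrite -{1}ea; apply: (is_inverse_mul invP) => //.
  exact: idempotent_is_inverse.
apply/and3P; split; rewrite ?bb ?be //.
(* If [b = e], then [a = a * b * a = a * e * a = e]. *)
by apply: contra_neq ane => bE; rewrite -iab.1 bE ae ea.
Qed.

Lemma strong_inverse_neq : b != a.
Proof.
have /and3P[/eqP aa /eqP ae ane] := a_root; have [[aba _] _] := ab.
by apply: contra_neq ane => bE; rewrite -aba bE -mulgA aa ae.
Qed.

End StrongInverse.

(** * Parity of [N e] for the collapsing idempotent *)

Section Collapse.
Variables (X : finType) (p q r s : X).
Hypothesis pqrs : uniq [:: p; q; r; s].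
Implicit Types (x : X) (a : transformation X).

Let neqs : (((p == q) = false) * ((p == r) = false) * ((p == s) = false) *
  ((q == r) = false) * ((q == s) = false) * ((r == s) = false)) *
  (((q == p) = false) * ((r == p) = false) * ((s == p) = false) *
  ((r == q) = false) * ((s == q) = false) * ((s == r) = false)).
Proof.
move: pqrs; rewrite /= !inE !negb_or !andbT.
case/and3P=> /and3P[pq pr ps] /andP[qr qs] rs.
by rewrite ![r == q]eq_sym ![s == q]eq_sym ![s == r]eq_sym ![_ == p]eq_sym;
  rewrite !(negbTE pq, negbTE pr, negbTE ps, negbTE qr, negbTE qs, negbTE rs).
Qed.

Let collapse : transformation X :=
  [ffun x => if x \in [:: q; r; s] then p else x].

Let fork : transformation X :=
  [ffun x => if x == s then p else if x \in [:: q; r] then s else x].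

Let swap a : transformation X := [ffun x => tperm q r (a (tperm q r x))].

Let mulE a b x : (a * b : transformation X) x = b (a x).
Proof. by rewrite ffunE. Qed.

Let tperm_fix x : x != q -> x != r -> tperm q r x = x.
Proof. by move=> xq xr; rewrite tpermD // eq_sym. Qed.

Lemma collapse_idempotent : collapse * collapse = collapse.
Proof.
apply/ffunP => x; rewrite mulE !ffunE.
by case: (x \in _) / boolP => [_|/negbTE ->]; rewrite // !inE !neqs.
Qed.

(** The pointwise conditions are [e * a = e], [a * e = e] and [a * a = e] evaluated at [x], where
    [e] is [collapse]. *)
Lemma square_root_collapseP a : square_roots collapse a ->
  [/\ forall x, x \notin [:: q; r; s] -> a x = x,
      forall x, x \in [:: q; r; s] -> a x \in [:: p; q; r; s],
      forall x, x \in [:: q; r; s] -> a (a x) = p & a != collapse].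
Proof.
case/and3P=> /eqP aa /eqP ae ane.
have ea : collapse * a = collapse by rewrite -[in RHS]ae -aa mulgA.
split=> // x xP.
- by have /ffunP/(_ x) := ea; rewrite mulE !ffunE (negbTE xP).
- have /ffunP/(_ x) := ae; rewrite mulE !ffunE xP.
  by case: ifP => [axP _|_ ->]; rewrite in_cons ?axP ?eqxx ?orbT.
by have /ffunP/(_ x) := aa; rewrite mulE !ffunE xP.
Qed.

Lemma swapK : involutive swap.
Proof. by move=> a; apply/ffunP=> x; rewrite !ffunE !tpermK. Qed.

Lemma swap_mul a b : swap (a * b) = swap a * swap b.
Proof. by apply/ffunP=> x; rewrite mulE !ffunE tpermK. Qed.

Lemma swap_collapse : swap collapse = collapse.
Proof.
apply/ffunP=> x; rewrite !ffunE.
have -> : (tperm q r x \in [:: q; r; s]) = (x \in [:: q; r; s]).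
  by rewrite !inE; case: tpermP => [->|->|]; rewrite ?eqxx ?orbT.
case: ifP => [_|]; last by rewrite tpermK.
by rewrite tperm_fix ?neqs.
Qed.

Lemma swap_square_roots a :
  square_roots collapse a -> square_roots collapse (swap a).
Proof.
case/and3P=> /eqP aa /eqP ae ane; apply/and3P; split.
- by rewrite -swap_mul aa swap_collapse.
- by rewrite -{1}swap_collapse -swap_mul ae swap_collapse.
by rewrite -swap_collapse (inj_eq (inv_inj swapK)).
Qed.

Lemma fork_square_root : square_roots collapse fork.
Proof.
apply/and3P; split.
- apply/eqP/ffunP=> x; rewrite mulE !ffunE !inE.
  have [->|xs] := eqVneq x s; first by rewrite !neqs orbT.
  have [->|xq] := eqVneq x q; first by rewrite /= eqxx.
  have [->|xr] := eqVneq x r; first by rewrite /= eqxx.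
  by rewrite /= (negbTE xs) (negbTE xq) (negbTE xr).
- apply/eqP/ffunP=> x; rewrite mulE !ffunE !inE.
  have [->|xs] := eqVneq x s; first by rewrite !neqs orbT.
  have [->|xq] := eqVneq x q; first by rewrite /= eqxx !orbT.
  have [->|xr] := eqVneq x r; first by rewrite /= eqxx !orbT.
  by rewrite /= (negbTE xs) (negbTE xq) (negbTE xr).
by apply/eqP => /ffunP/(_ q)/eqP; rewrite !ffunE !inE eqxx !neqs.
Qed.

Lemma swap_fixed a : square_roots collapse a -> swap a = a -> a = fork.
Proof.
move=> /square_root_collapseP[a_id a_im aa ane] /ffunP fix_a.
have ap : a p = p by apply: a_id; rewrite !inE !neqs.
have a2 : [/\ a (a q) = p, a (a r) = p & a (a s) = p].
  by split; apply: aa; rewrite !inE eqxx ?orbT.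
(* Being fixed by [swap] means commuting with the transposition. *)
have arE : a r = tperm q r (a q) by rewrite -(fix_a r) ffunE tpermR.
have asE : tperm q r (a s) = a s.
  by rewrite -[in RHS](fix_a s) ffunE (tperm_fix (x := s)) ?neqs.
(* The transposition fixes [a s], which rules out [q] and [r]; [a s = s] would contradict
   [a (a s) = p]. *)
have as_p : a s = p.
  have := a_im s; rewrite !inE eqxx !orbT => /(_ isT).
  case/or4P=> /eqP as_; rewrite as_ //.
  - by move: asE; rewrite as_ tpermL => /eqP; rewrite neqs.
  - by move: asE; rewrite as_ tpermR => /eqP; rewrite neqs.
  - by case: a2 => _ _; rewrite !as_ => /eqP; rewrite neqs.
(* The value [p] forces [a = collapse], [q] makes [q] a fixed point of [a], and [r] makes [a]
   exchange [q] and [r]; the last two contradict [a (a q) = p]. *)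
have aq : a q = s.
  have := a_im q; rewrite !inE eqxx /= => /(_ isT).
  case/or4P=> /eqP aq //.
  - case/eqP: ane; apply/ffunP => x; rewrite ffunE.
    case: ifP => [|/negbT/a_id //].
    rewrite !inE => /or3P[] /eqP-> //.
    by rewrite arE aq tperm_fix ?neqs.
  - by case: a2; rewrite !aq => /eqP; rewrite neqs.
  - by case: a2; rewrite aq arE aq tpermR => /eqP; rewrite neqs.
have ar : a r = s by rewrite arE aq tperm_fix ?neqs.
apply/ffunP=> x; rewrite ffunE.
have [->//|xs] := eqVneq x s; case: ifP => [|xqr].
  by rewrite !inE => /orP[] /eqP->.
by apply: a_id; move: xqr; rewrite !inE => /norP[/negbTE-> /negbTE->].
Qed.

Lemma odd_square_roots_collapse : odd #|[set a | square_roots collapse a]|.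
Proof.
rewrite (cardsD1 fork) inE fork_square_root /=.
have swap_fork : swap fork = fork.
  apply/ffunP=> x; rewrite !ffunE.
  have [->|xs] := eqVneq x s.
    by rewrite !(tperm_fix (x := s)) ?neqs // eqxx tperm_fix ?neqs.
  have [->|xq] := eqVneq x q.
    by rewrite tpermL !inE eqxx !neqs ?eqxx ?orbT tperm_fix ?neqs.
  have [->|xr] := eqVneq x r.
    by rewrite tpermR !inE eqxx !neqs ?eqxx ?orbT tperm_fix ?neqs.
  rewrite (tperm_fix xq xr) !inE (negbTE xs) (negbTE xq) (negbTE xr).
  by rewrite tperm_fix.
(* Once [fork] is removed, [swap] acts without fixed points. *)
apply: (@card_even_fixfree_involution _ _ swap) => a; rewrite !inE.
- case/andP=> af ra; rewrite swap_square_roots // andbT.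
  by rewrite -swap_fork (inj_eq (inv_inj swapK)).
- by case/andP=> af ra; apply: contra_neq af; apply: swap_fixed.
- by move=> _; apply: swapK.
Qed.

Lemma no_involution_matching_strong (inv : transformation X -> transformation X) :
  ~ involution_matching_strong inv.
Proof.
case=> invK inv_strong; apply/negP: odd_square_roots_collapse.
apply: (@card_even_fixfree_involution _ _ inv) => a; rewrite ?inE => ra.
- exact: strong_inverse_square_roots collapse_idempotent ra (inv_strong a).
- exact: strong_inverse_neq ra (inv_strong a).
- exact: invK.
Qed.

End Collapse.

Theorem mainTheorem5 (n : nat) (X : finType) (hn : 4 <= n) (hX : #|X| = n) :
  ~ exists inv : transformation X -> transformation X,
      involution_matching_strong inv.
Proof.
(* The four points are the first four entries of [enum X]. *)
case=> inv; move: hn (enum_uniq X); rewrite -hX cardE.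
case: (enum X) => [|p [|q [|r [|s l]]]] // _.
rewrite (cat_uniq [:: p; q; r; s] l) => /andP[pqrs _].
exact: no_involution_matching_strong pqrs inv.
Qed.
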